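(* $\mathrm{ex}'(n,\{\text{taco},\text{nested},\text{crossing}\})\in O(n)$.
   Context: Let $P$ be a set of $n$ points in convex position in the plane (the vertices of a convex $n$-gon); a triangle on $P$ is a 3-element subset of $P$. For two distinct triangles $t_1,t_2$ on $P$, label each point of $t_1\cup t_2$ by the triangle(s) containing it and read the points in their cyclic order around the polygon. The pair forms exactly one of eight configurations. (i) If $t_1,t_2$ share two vertices $u,v$: ''taco'' if their third vertices lie on the same side of the line $uv$, ''mariposa'' if on opposite sides. (ii) If they share exactly one vertex $v$: read the remaining four vertices in cyclic order starting just after $v$; ''bat'' if the pattern is $t_1t_1t_2t_2$ or $t_2t_2t_1t_1$, ''nested'' if it is $t_1t_2t_2t_1$ or $t_2t_1t_1t_2$, ''crossing'' if it is $t_1t_2t_1t_2$ or $t_2t_1t_2t_1$. (iii) If they share no vertex, the cyclic sequence of the six labels is, up to rotation, reflection and exchanging the roles of $t_1,t_2$, one of: ''ears'' $AAABBB$, ''swords'' $AABABB$, ''david'' $ABABAB$. Top/bottom variant: partition the vertices of the convex $n$-gon by a horizontal line into a top half of $\lceil n/2\rceil$ vertices and a bottom half of $\lfloor n/2\rfloor$ vertices (each half consisting of consecutive vertices along the polygon). For a set $X$ of configurations, $\mathrm{ex}'(n,X)$ is the maximum size of a family of triangles on $P$, each having exactly two vertices in the top half and one vertex in the bottom half, in which no two triangles form a configuration belonging to $X$. *)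

(* Defs.v *)
From HB Require Import structures.
From mathcomp Require Import all_boot all_order all_algebra.
From mathcomp Require Import boolp classical_sets reals.

Set Implicit Arguments.
Unset Strict Implicit.
Unset Printing Implicit Defensive.

Import Order.TTheory GRing.Theory Num.Theory.

Local Open Scope ring_scope.

Definition plane (R : realType) := (R * R)%type.

(* Twice the signed area of the triangle abc: it is positive iff a, b, c make a
   left turn, and its sign tells on which side of the line ab the point c lies. *)
Definition orient (R : realType) (a b c : plane R) : R :=
  (b.1 - a.1) * (c.2 - a.2) - (b.2 - a.2) * (c.1 - a.1).

(* p 0, ..., p (n - 1) are the vertices of a (strictly) convex n-gon, listed
   counterclockwise. *)
Definition convex_ngon (R : realType) (n : nat) (p : 'I_n -> plane R) : Prop :=
  forall i j k : 'I_n, (i < j < k)%N -> 0 < orient (p i) (p j) (p k).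

(* The numbering starts at the first vertex of the top half; note that
   uphalf n is the ceiling of n / 2. *)
Definition top_half (n : nat) : {set 'I_n} := [set i : 'I_n | (i < uphalf n)%N]%SET.
Definition bottom_half (n : nat) : {set 'I_n} := (~: top_half n)%SET.

Definition horizontally_split (R : realType) (n : nat) (p : 'I_n -> plane R) : Prop :=
  exists h : R,
    (forall i, i \in top_half n -> h < (p i).2) /\
    (forall i, i \in bottom_half n -> (p i).2 < h).

(* A triangle is a 3-element set of vertex indices. *)
Definition is_triangle (n : nat) (t : {set 'I_n}) : Prop := #|t| = 3%N.

Variant config :=
  Taco | Mariposa | Bat | Nested | Crossing | Ears | Swords | David.

Section Configurations.
Variables (R : realType) (n : nat) (p : 'I_n -> plane R).
Implicit Types (t : {set 'I_n}) (u v a b : 'I_n).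

(* The labels are booleans: true stands for t1 and false for t2. *)

Definition labels_after v t1 t2 : seq bool :=
  [seq x \in t1 | x <- rot v.+1 (enum 'I_n) & x \in ((t1 :|: t2) :\ v)%SET].

Definition labels t1 t2 : seq bool :=
  [seq x \in t1 | x <- enum 'I_n & x \in (t1 :|: t2)%SET].

Definition same_cyclic_pattern (s w : seq bool) : Prop :=
  exists k : nat,
    rot k s \in [:: w; rev w; map negb w; rev (map negb w)].

Definition share_two t1 t2 u v a b : Prop :=
  [/\ uniq [:: u; v; a; b],
      t1 = [set u; v; a]%SET & t2 = [set u; v; b]%SET].

Definition share_one_pattern t1 t2 (w : seq bool) : Prop :=
  exists v, (t1 :&: t2)%SET = [set v]%SET /\
    (labels_after v t1 t2 = w \/ labels_after v t1 t2 = map negb w).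

Definition share_none_pattern t1 t2 (w : seq bool) : Prop :=
  [disjoint t1 & t2] /\ same_cyclic_pattern (labels t1 t2) w.

Definition forms t1 t2 (c : config) : Prop :=
  match c with
  | Taco => exists u v a b, share_two t1 t2 u v a b /\
      0 < orient (p u) (p v) (p a) * orient (p u) (p v) (p b)
  | Mariposa => exists u v a b, share_two t1 t2 u v a b /\
      orient (p u) (p v) (p a) * orient (p u) (p v) (p b) < 0
  | Bat => share_one_pattern t1 t2 [:: true; true; false; false]
  | Nested => share_one_pattern t1 t2 [:: true; false; false; true]
  | Crossing => share_one_pattern t1 t2 [:: true; false; true; false]
  | Ears => share_none_pattern t1 t2 [:: true; true; true; false; false; false]
  | Swords => share_none_pattern t1 t2 [:: true; true; false; true; false; false]
  | David => share_none_pattern t1 t2 [:: true; false; true; false; true; false]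
  end.

Definition two_top_one_bottom (t : {set 'I_n}) : Prop :=
  #|(t :&: top_half n)%SET| = 2%N /\ #|(t :&: bottom_half n)%SET| = 1%N.

Definition avoids (X : set config) (F : {set {set 'I_n}}) : Prop :=
  forall t1 t2, t1 \in F -> t2 \in F -> t1 <> t2 ->
    forall c, X c -> ~ forms t1 t2 c.

Definition admissible (X : set config) (F : {set {set 'I_n}}) : Prop :=
  (forall t, t \in F -> is_triangle t /\ two_top_one_bottom t) /\ avoids X F.

End Configurations.

(* The maximum is also taken over the realisations p of the convex n-gon; the
   configurations depend only on the cyclic order, so the value is the same for
   each single p. *)
Definition ex' (R : realType) (n : nat) (X : set config) : nat :=
  \max_(F : {set {set 'I_n}} |
        `[< exists p : 'I_n -> plane R,
            [/\ convex_ngon p, horizontally_split p & admissible p X F] >]) #|F|.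

(* Main.v *)
Require Import Defs.
From mathcomp Require Import all_boot all_order all_algebra.
From mathcomp Require Import boolp classical_sets reals topology normedtype landau.
From mathcomp Require Import zify ring.
Import numFieldNormedType.Exports.
Set Implicit Arguments.
Unset Strict Implicit.
Unset Printing Implicit Defensive.
Import Order.TTheory GRing.Theory Num.Theory.
Local Open Scope ring_scope.
Local Open Scope classical_set_scope.

(** Number the vertices so that the top half comes first and write a triangle as
    [a < b < c], with [a, b] on top and [c] at the bottom. Two distinct triangles
    [a, b, c] and [a, b', c'] with the same first vertex are always in a
    forbidden configuration: if they share a second vertex they form a taco, and
    otherwise, reading from [a], the vertices [b, b'] precede [c, c'], so that
    the labels alternate (crossing) or are nested. Hence a triangle is determined
    by its first vertex and the family has at most [n] members. *)

(** The rotation only moves indices below [k] to the end, and none of these belongs to [s], so the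
    filter does not notice it. *)
Lemma filter_rot_enum_ord (n k : nat) (s : seq 'I_n) :
    sorted ltn (map val s) -> (forall x, x \in s -> k <= x)%N ->
  [seq x <- rot k (enum 'I_n) | x \in s] = s.
Proof.
move=> srt_s ge_k.
have take0 : [seq x <- take k (enum 'I_n) | x \in s] = [::].
  apply/eqP; rewrite -[_ == _]negbK -has_filter; apply/hasPn => x.
  rewrite in_take ?mem_enum // index_enum_ord => lt_xk.
  by apply/negP => /ge_k; rewrite leqNgt lt_xk.
rewrite /rot filter_cat take0 cats0.
have -> : [seq x <- drop k (enum 'I_n) | x \in s] =
          [seq x <- enum 'I_n | x \in s].
  by rewrite -{2}(cat_take_drop k (enum 'I_n)) filter_cat take0.
(* Both lists are now strictly increasing and have the same elements, hence they coincide. *)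
rewrite sorted_map in srt_s.
apply: (irr_sorted_eq (leT := relpre val ltn)) => //.
- by move=> y x z /=; apply: ltn_trans.
- by move=> x /=; rewrite ltnn.
- apply: sorted_filter; first by move=> y x z /=; apply: ltn_trans.
  by rewrite -sorted_map val_enum_ord iota_ltn_sorted.
- by move=> x; rewrite mem_filter mem_enum andbT.
Qed.

(** Since [v] precedes all the other vertices, reading cyclically from [v] never wraps around; the
    labels can thus be computed on an explicit increasing list. *)
Lemma labels_after_sorted (n : nat) (v : 'I_n) (t1 t2 : {set 'I_n})
    (s : seq 'I_n) :
    path ltn v (map val s) -> ((t1 :|: t2) :\ v)%SET =i s ->
  labels_after v t1 t2 = [seq x \in t1 | x <- s].
Proof.
move=> vs sE; rewrite /labels_after (eq_filter sE) filter_rot_enum_ord //.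
  exact: path_sorted vs.
move=> x xs; have /allP := order_path_min ltn_trans vs.
by apply; rewrite map_f.
Qed.

Lemma two_top_one_bottomP (n : nat) (t : {set 'I_n}) :
    two_top_one_bottom t ->
  exists a b c : 'I_n, [/\ (a < b)%N, (b < uphalf n)%N, (uphalf n <= c)%N
    & t = [set a; b; c]%SET].
Proof.
move=> [/eqP/cards2P[a [b [neq_ab topE]]] /eqP/cards1P[c botE]].
have tE : t = [set a; b; c]%SET by rewrite -topE -botE -finset.setDE finset.setID.
have top_lt x : x \in [set a; b]%SET -> (x < uphalf n)%N.
  by rewrite -topE !inE => /andP[].
have ge_c : (uphalf n <= c)%N.
  by have := set11 c; rewrite -botE !inE -leqNgt => /andP[].
have lt_a := top_lt a (set21 a b); have lt_b := top_lt b (set22 a b).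
have [lt_ab|lt_ba|eq_ab] := ltngtP a b; first by exists a, b, c.
  by exists b, a, c; split=> //; rewrite (finset.setUC [set b]%SET).
by rewrite (val_inj eq_ab) eqxx in neq_ab.
Qed.

Lemma orient_swap (R : realType) (a b c : plane R) :
  orient a c b = - orient a b c.
Proof. by rewrite /orient; ring. Qed.

Section SameFirstVertex.
Variables (R : realType) (n : nat) (p : 'I_n -> plane R).
Hypothesis p_convex : convex_ngon p.
Variables a b c b' c' : 'I_n.
Hypotheses (lt_ab : (a < b)%N) (lt_ab' : (a < b')%N).
Hypotheses (lt_bc : (b < c)%N) (lt_bc' : (b' < c')%N).

Lemma same_first_two_taco :
  b = b' -> c <> c' -> forms p [set a; b; c]%SET [set a; b'; c']%SET Taco.
Proof.
move=> eq_b neq_c; subst b'; exists a, b, c, c'; split.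
  split=> //=; rewrite !inE -!val_eqE /=.
  by move/eqP: neq_c; rewrite -val_eqE /=; lia.
(* Both third vertices come after [a] and [b], so both turns are to the left. *)
by rewrite mulr_gt0 // p_convex ?lt_ab.
Qed.

Lemma same_first_last_taco :
  b <> b' -> c = c' -> forms p [set a; b; c]%SET [set a; b'; c']%SET Taco.
Proof.
(* The shared edge joins [a] and [c]; both [b] and [b'] lie between them in the numbering, so both
   orientations are negative and their product is positive. *)
move=> neq_b eq_c; subst c'; exists a, c, b, b'; split.
  split; try exact: finset.setUAC.
  rewrite /= !inE -!val_eqE /=.
  by move/eqP: neq_b; rewrite -val_eqE /=; lia.
by rewrite (orient_swap (p a) (p b)) (orient_swap (p a) (p b')) mulrNN mulr_gt0 // p_convex ?lt_ab ?lt_ab'.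
Qed.

(** After [a] come [b], then [b'], then [c] and [c'] in some order: [c] first gives the alternating
    pattern, [c'] first the nested one. *)
Lemma same_first_crossing_or_nested :
    (b < b')%N -> (b' < c)%N -> c <> c' ->
  forms p [set a; b; c]%SET [set a; b'; c']%SET Crossing \/
  forms p [set a; b; c]%SET [set a; b'; c']%SET Nested.
Proof.
move=> lt_bb' lt_b'c /eqP; rewrite -val_eqE /= => neq_c.
have capE : ([set a; b; c] :&: [set a; b'; c'])%SET = [set a]%SET.
  by apply/setP=> x; rewrite !inE -!val_eqE /=; lia.
have [lt_cc'|lt_c'c|eq_c] := ltngtP c c'; last by rewrite eq_c eqxx in neq_c.
- left; exists a; split=> //; left.
  rewrite (labels_after_sorted (s := [:: b; b'; c; c'])) /=.
  + by rewrite !inE -!val_eqE /=; congr [:: _; _; _; _]; lia.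
  + by lia.
  + by move=> x; rewrite !inE -!val_eqE /=; lia.
- right; exists a; split=> //; left.
  rewrite (labels_after_sorted (s := [:: b; b'; c'; c])) /=.
  + by rewrite !inE -!val_eqE /=; congr [:: _; _; _; _]; lia.
  + by lia.
  + by move=> x; rewrite !inE -!val_eqE /=; lia.
Qed.

End SameFirstVertex.

Lemma admissible_same_first (R : realType) (n : nat) (p : 'I_n -> plane R)
    (F : {set {set 'I_n}}) (a b c b' c' : 'I_n) :
    convex_ngon p -> admissible p [set Taco; Nested; Crossing] F ->
    (a < b < uphalf n)%N -> (a < b' < uphalf n)%N ->
    (uphalf n <= c)%N -> (uphalf n <= c')%N ->
    [set a; b; c]%SET \in F -> [set a; b'; c']%SET \in F ->
  [set a; b; c]%SET = [set a; b'; c']%SET.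
Proof.
move=> p_convex [_ avF].
(* The conclusion is symmetric in the two triangles. *)
wlog le_bb' : b c b' c' / (b <= b')%N => [hw|].
  have [le_bb'|/ltnW le_b'b] := leqP b b'; first exact: hw.
  by move=> *; apply/esym/hw.
move=> /andP[lt_ab ltb] /andP[lt_ab' ltb'] gec gec' t1F t2F.
apply: contrapT => neq_t.
have avoid := avF _ _ t1F t2F neq_t.
have noTaco : ~ forms p [set a; b; c]%SET [set a; b'; c']%SET Taco.
  by apply: avoid; left; left.
have lt_bc := leq_trans ltb gec; have lt_bc' := leq_trans ltb' gec'.
have [eq_b|/eqP neq_b] := eqVneq b b'.
  apply/noTaco/same_first_two_taco => // eq_c.
  by apply: neq_t; rewrite eq_b eq_c.
have [eq_c|/eqP neq_c] := eqVneq c c'; first exact/noTaco/same_first_last_taco.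
have lt_bb' : (b < b')%N by rewrite ltn_neqAle le_bb' andbT; apply/eqP=> /val_inj.
have [] := same_first_crossing_or_nested p lt_ab lt_ab' lt_bc lt_bc'
  lt_bb' (leq_trans ltb' gec) neq_c.
- by apply: avoid; right.
- by apply: avoid; left; right.
Qed.

Lemma card_admissible_le (R : realType) (n : nat) (p : 'I_n -> plane R)
    (F : {set {set 'I_n}}) :
    convex_ngon p -> admissible p [set Taco; Nested; Crossing] F ->
  (#|F| <= n)%N.
Proof.
move=> p_convex admF; have [->|[t0 t0F]] := set_0Vmem F; first by rewrite cards0.
have repr t : t \in F -> exists a b c : 'I_n,
    [/\ (a < b)%N, (b < uphalf n)%N, (uphalf n <= c)%N & t = [set a; b; c]%SET].
  by move=> /(proj1 admF)[_ /two_top_one_bottomP].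
(* [a0] is the default value of [first] outside [F]; it is taken from a member of [F] because ['I_n]
   may be empty. *)
have [a0 _] := repr t0 t0F.
have /choice[first firstP] : forall t, exists a : 'I_n, t \in F ->
    exists b c : 'I_n, [/\ (a < b)%N, (b < uphalf n)%N, (uphalf n <= c)%N
      & t = [set a; b; c]%SET].
  move=> t; have [/repr[a aP]|_] := boolP (t \in F); first by exists a.
  by exists a0.
rewrite -[leqRHS]card_ord -(card_in_imset (f := first) (D := F)) ?max_card //.
move=> t1 t2 t1F t2F eq_first.
have [b [c [lt_ab lt_b ge_c t1E]]] := firstP t1 t1F.
have [b' [c' [lt_ab' lt_b' ge_c' t2E]]] := firstP t2 t2F.
rewrite -eq_first in lt_ab' t2E; rewrite t1E t2E.
by apply: (admissible_same_first (p := p)) admF _ _ _ _ _ _;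
  rewrite -?t1E -?t2E ?lt_ab ?lt_ab'.
Qed.

Lemma ex'_taco_nested_crossing_le (R : realType) (n : nat) :
  (ex' R n [set Taco; Nested; Crossing] <= n)%N.
Proof.
apply/bigmax_leqP => F /asboolP[p [p_convex _ admF]].
exact: card_admissible_le admF.
Qed.

Theorem theorem5 (R : realType) :
  (fun n : nat => (ex' R n [set Taco; Nested; Crossing])%:R : R^o)
    =O_\oo (fun n : nat => n%:R : R^o).
Proof.
apply/eqO_exP; exists 1 => //; apply: filterE => n.
by rewrite mul1r !normr_nat ler_nat ex'_taco_nested_crossing_le.
Qed.
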